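(* Fix $i\in I$ and multipliers $\mathbf{u}^t=(u^t_j)_{j\in J}\in\mathbb{R}^{|J|}$, and consider the subproblem $$\left(\text{R-EoS-SSD}^{(i),t}\right)\qquad \min_{\mu_i,\,(y_{ij})_{j\in J}}\ \min_{k\in K}\Big\{ v^{i,k}(1,\mu_i,y_{ij})-\sum_{j\in J}u^t_j y_{ij}\Big\}$$ subject to $\mu_i-\sum_{j\in J}\lambda_j y_{ij}\ge 0$, $\mu_i\ge 0$, and $y_{ij}\in\{0,1\}$ for all $j\in J$, with $v^{i,k}$ as defined in the context. For $k\in K$ put $$p^{i,k}=f_i+c_i g_i(\mu^k)-c_i g_i'(\mu^k)\mu^k,\qquad r_j^{i,k}=4 w_i c_i g_i'(\mu^k)\lambda_j,\qquad q_j^{i,k}=s_i\lambda_j+a_{ij}\lambda_j+c_i g_i'(\mu^k)\lambda_j \quad (j\in J),$$ and define $z^{i,k}$ by $$z^{i,k}-p^{i,k}=\min_{y\in\{0,1\}^{J}}\ \Big\{\sum_{j\in J}\left(q_j^{i,k}-u_j^t\right)y_j+\sqrt{\sum_{j\in J} r_j^{i,k}y_j}\Big\}.$$ Let $k(i)\in\operatorname{argmin}_{k\in K} z^{i,k}$, let $(y^*_{ij})_{j\in J}\in\{0,1\}^J$ be a minimizer of the binary problem defining $z^{i,k(i)}$ (that is, the problem displayed above with $k=k(i)$), and let $$\mu_i^*=\sum_{j\in J}\lambda_j y^*_{ij}+\sqrt{\frac{w_i\sum_{j\in J}\lambda_j y^*_{ij}}{c_i\, g_i'(\mu^{k(i)})}}.$$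 Then $(\mu_i^*,(y^*_{ij})_{j\in J})$ is an optimal solution of $\text{R-EoS-SSD}^{(i),t}$.
   Context: $I$ is a finite set of potential service facility locations, $J$ a finite set of customers, and $K$ a finite nonempty index set of tangent points. The data are: $\lambda_j\ge 0$ the demand rate of customer $j\in J$; for facility $i\in I$, $f_i$ the fixed opening cost, $c_i>0$ the operating cost, $s_i$ the service cost, $w_i>0$ the waiting cost per customer per time unit; $a_{ij}$ the access cost of customer $j$ to facility $i$ (all real numbers). The variable $\mu_i\ge0$ is the service rate of facility $i$, and $y_{ij}\in\{0,1\}$ indicates whether customer $j$ is assigned to facility $i$. The function $g_i$ is real-valued, concave and non-decreasing; $\mu^k$, $k\in K$, are given points at which $g_i$ is differentiable, with $g_i'(\mu^k)>0$. (The functions $\hat g_i^k(\mu)=g_i(\mu^k)+g_i'(\mu^k)(\mu-\mu^k)$ are the tangent lines used for a piecewise-linear approximation $\min_{k\in K}\hat g_i^k$ of $g_i$.) For $i\in I$ and $k\in K$, $$v^{i,k}(x_i,\mu_i,y_{ij}):=\left(f_i+c_i g_i(\mu^k)-c_i\mu^k g_i'(\mu^k)\right)x_i+c_i g_i'(\mu^k)\mu_i+\sum_{j\in J}s_i\lambda_j y_{ij}+\sum_{j\in J}a_{ij}\lambda_j y_{ij}+w_i\frac{\sum_{j\in J}\lambda_j y_{ij}}{\mu_i-\sum_{j\in J}\lambda_j y_{ij}}.$$ Here the last term (waiting cost) is read as $0$ when $\sum_{j\in J}\lambda_j y_{ij}=0$ (including when $\mu_i=0$), and as $+\infty$ when $\mu_i=\sum_{j\in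 J}\lambda_j y_{ij}>0$. *)

(* Defs.v *)
From mathcomp Require Import all_boot all_order all_algebra.
From mathcomp Require Import all_classical all_reals all_analysis.

Set Implicit Arguments.
Unset Strict Implicit.
Unset Printing Implicit Defensive.

Import Order.TTheory GRing.Theory Num.Theory.
Import numFieldNormedType.Exports.

Local Open Scope classical_set_scope.
Local Open Scope ring_scope.

(* Facilities I, customers J, tangent points K.  The sign, concavity and
   differentiability assumptions are kept out of the record. *)
Record ssd_data (R : realType) (I J K : finType) := SsdData {
  demand : J -> R;                (* lambda_j *)
  open_cost : I -> R;             (* f_i *)
  oper_cost : I -> R;             (* c_i *)
  serv_cost : I -> R;             (* s_i *)
  wait_cost : I -> R;             (* w_i *)
  access_cost : I -> J -> R;      (* a_ij *)
  cap_fun : I -> R -> R;          (* g_i *)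
  tangent_pt : K -> R             (* mu^k, common to all facilities *)
}.

(* The domain of a service-rate function is [0, +oo[, the range of service
   rates; a function concave on the whole line is covered as well. *)
Definition concave_on_rates (R : realType) (g : R -> R) : Prop :=
  convex_function (E := R^o) `[0, +oo[ (fun x => - g x).

Definition nondecreasing_on_rates (R : realType) (g : R -> R) : Prop :=
  {in `[0, +oo[ &, {homo g : x y / x <= y}}.

Definition minimizer (disp : Order.disp_t) (V : porderType disp) (T : Type)
    (A : set T) (F : T -> V) (x : T) : Prop :=
  A x /\ forall x', A x' -> (F x <= F x')%O.

Section SSD.
Context {R : realType} {I J K : finType}.
Variable D : ssd_data R I J K.

Local Notation lambda := (demand D).
Local Notation f := (open_cost D).
Local Notation c := (oper_cost D).
Local Notation s := (serv_cost D).
Local Notation w := (wait_cost D).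
Local Notation a := (access_cost D).
Local Notation g := (cap_fun D).
Local Notation mu_ := (tangent_pt D).

Definition slope (i : I) (k : K) : R := derive1 (g i) (mu_ k).

(* The binary vector (y_ij)_j of a fixed facility i is a function J -> bool. *)
Definition load (y : {ffun J -> bool}) : R := \sum_j lambda j * (y j)%:R.

(* Extended-real waiting cost: 0 without load (even if mu = 0), +oo if the
   service rate equals a nonzero load. *)
Definition waiting (i : I) (mu : R) (y : {ffun J -> bool}) : \bar R :=
  if load y == 0 then 0%E
  else if mu == load y then +oo%E
  else (w i * (load y / (mu - load y)))%:E.

Definition v (i : I) (k : K) (x mu : R) (y : {ffun J -> bool}) : \bar R :=
  (((f i + c i * g i (mu_ k) - c i * mu_ k * slope i k) * x
    + c i * slope i k * mu
    + \sum_j s i * lambda j * (y j)%:R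
    + \sum_j a i j * lambda j * (y j)%:R)%:E
   + waiting i mu y)%E.

Definition feasible : set (R * {ffun J -> bool}) :=
  [set m | 0 <= m.1 - load m.2 /\ 0 <= m.1].

(* +oo is the neutral element of min; for nonempty K this is the minimum. *)
Definition objective (i : I) (u : J -> R) (m : R * {ffun J -> bool}) : \bar R :=
  \big[mine/+oo%E]_(k : K) (v i k 1 m.1 m.2 - (\sum_j u j * (m.2 j)%:R)%:E)%E.

Definition p (i : I) (k : K) : R :=
  f i + c i * g i (mu_ k) - c i * slope i k * mu_ k.

Definition r (i : I) (k : K) (j : J) : R :=
  4 * w i * c i * slope i k * lambda j.

Definition q (i : I) (k : K) (j : J) : R :=
  s i * lambda j + a i j * lambda j + c i * slope i k * lambda j.

Definition binary_obj (i : I) (u : J -> R) (k : K) (y : {ffun J -> bool}) : R :=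
  \sum_j (q i k j - u j) * (y j)%:R + Num.sqrt (\sum_j r i k j * (y j)%:R).

(* The default value of the iterated minimum is the value at y = 0, so this is
   p plus the minimum of binary_obj over all binary vectors. *)
Definition z (i : I) (u : J -> R) (k : K) : R :=
  p i k + \big[Num.min/binary_obj i u k [ffun=> false]]_(y : {ffun J -> bool})
            binary_obj i u k y.

Definition mu_opt (i : I) (k : K) (y : {ffun J -> bool}) : R :=
  load y + Num.sqrt (w i * load y / (c i * slope i k)).

End SSD.

(* Main.v *)
Require Import Defs.
From mathcomp Require Import all_boot all_order all_algebra.
From mathcomp Require Import all_classical all_reals all_analysis.
From mathcomp Require Import ring.

(** The service rate can be eliminated in closed form.  Fix a tangent k and an
    assignment y of load L, write A = c_i g_i'(mu^k) > 0 and mu = L + d with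
    d >= 0.  The linear part A mu splits as A L + A d; the term A L is absorbed
    by the coefficients q, and the part of the cost that still depends on the
    rate is A d + w_i L / d.  By the arithmetic-geometric mean inequality it is
    at least sqrt (4 A w_i L), which is the square root in [binary_obj], with
    equality at d = sqrt (w_i L / A), which is the slack chosen by [mu_opt].
    Hence, for every k, [p + binary_obj] bounds the k-th cost from below on
    feasible points ([tangent_obj_ge]) and is its value at [mu_opt]
    ([tangent_obj_mu_opt]).

    As minima over k, mu and y commute, the value [z ki] is a lower bound for
    the whole subproblem: it is at most every [z k], hence at most every tangent
    cost at every feasible point.  The proposed point attains it through the
    tangent ki alone. *)

Set Implicit Arguments.
Unset Strict Implicit.
Unset Printing Implicit Defensive.

Import Order.TTheory GRing.Theory Num.Theory.
Import numFieldNormedType.Exports.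

Local Open Scope classical_set_scope.
Local Open Scope ring_scope.

Section EliminateRate.
Context {R : realType}.

(** Arithmetic-geometric mean: the squares of the two sides differ by
    (A d - b / d)^2. *)
Lemma sqrt_le_hyperbola (A b d : R) : 0 < A -> 0 <= b -> 0 < d ->
  Num.sqrt (4 * A * b) <= A * d + b / d.
Proof.
move=> A0 b0 d0; have Ad0 : 0 < A * d by rewrite mulr_gt0.
have bd0 : 0 <= b / d by rewrite divr_ge0 // ltW.
rewrite -[leRHS]ger0_norm ?addr_ge0 ?(ltW Ad0) // -sqrtr_sqr.
apply: ler_wsqrtr; rewrite -subr_ge0.
have -> : (A * d + b / d) ^+ 2 - 4 * A * b = (A * d - b / d) ^+ 2.
  by field; rewrite gt_eqF.
exact: sqr_ge0.
Qed.

(** Equality case of [sqrt_le_hyperbola]: at d = sqrt (b / A) the two summands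
    A d and b / d coincide. *)
Lemma hyperbola_at_min (A b : R) : 0 < A -> 0 < b ->
  A * Num.sqrt (b / A) + b / Num.sqrt (b / A) = Num.sqrt (4 * A * b).
Proof.
move=> A0 b0; set d := Num.sqrt (b / A).
have d0 : 0 < d by rewrite sqrtr_gt0 divr_gt0.
have bE : b = A * d ^+ 2.
  by rewrite sqr_sqrtr ?divr_ge0 ?ltW // mulrC divfK // gt_eqF.
have -> : 4 * A * b = (2 * A * d) ^+ 2 by rewrite bE; ring.
rewrite sqrtr_sqr ger0_norm; last by rewrite !mulr_ge0 ?ltW.
by rewrite [in b / d]bE; field; rewrite gt_eqF.
Qed.

End EliminateRate.

Section Subproblem.
Context {R : realType} {I J K : finType}.
Variables (D : ssd_data R I J K) (i : I) (u : J -> R).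
Hypothesis demand_ge0 : forall j, 0 <= demand D j.
Hypothesis oper_cost_gt0 : 0 < oper_cost D i.
Hypothesis wait_cost_gt0 : 0 < wait_cost D i.
Hypothesis slope_gt0 : forall k, 0 < slope D i k.

Local Notation A k := (oper_cost D i * slope D i k).

Definition tangent_obj (k : K) (m : R * {ffun J -> bool}) : \bar R :=
  (v D i k 1 m.1 m.2 - (\sum_j u j * (m.2 j)%:R)%:E)%E.

Lemma load_ge0 (y : {ffun J -> bool}) : 0 <= load D y.
Proof. by apply: sumr_ge0 => j _; rewrite mulr_ge0. Qed.

Lemma rate_coef_gt0 (k : K) : 0 < A k.
Proof. exact: mulr_gt0. Qed.

(** Identifies the radicand of [binary_obj] with the constant 4 A b of the
    hyperbola A d + b / d that the rate traces, b being w_i times the load. *)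
Lemma sum_r_load (k : K) (y : {ffun J -> bool}) :
  \sum_j r D i k j * (y j)%:R = 4 * A k * (wait_cost D i * load D y).
Proof.
rewrite /load !mulr_sumr; apply: eq_bigr => j _.
by rewrite /r; ring.
Qed.

(** Isolates the dependence on the rate: writing A mu = A L + A (mu - L) moves
    A L into the coefficients q, and the remaining terms depend on the rate
    only through the slack mu - L. *)
Lemma tangent_objE (k : K) (mu : R) (y : {ffun J -> bool}) :
  tangent_obj k (mu, y) =
  ((p D i k + \sum_j (q D i k j - u j) * (y j)%:R + A k * (mu - load D y))%:E
   + waiting D i mu y)%E.
Proof.
have sumE : \sum_j (q D i k j - u j) * (y j)%:R =
    \sum_j serv_cost D i * demand D j * (y j)%:R
  + \sum_j access_cost D i j * demand D j * (y j)%:R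
  + A k * load D y - \sum_j u j * (y j)%:R.
  rewrite /load mulr_sumr -!big_split /= -sumrB; apply: eq_bigr => j _.
  by rewrite /q; ring.
rewrite /tangent_obj /v /= addeAC -EFinB sumE /p; congr (_%:E + _)%E.
by ring.
Qed.

(** The bound is uniform in the rate.  The conventions for the waiting cost
    agree with it: without load the square root vanishes and the slack only
    adds cost, and a positive load without slack costs +oo. *)
Lemma tangent_obj_ge (k : K) (m : R * {ffun J -> bool}) : feasible D m ->
  ((p D i k + binary_obj D i u k m.2)%:E <= tangent_obj k m)%E.
Proof.
case: m => mu y [/= mu_ge _]; rewrite tangent_objE /waiting /binary_obj.
rewrite sum_r_load.
have [L0|L0] := eqVneq (load D y) 0.
  rewrite adde0 lee_fin [in Num.sqrt _]L0 !mulr0 sqrtr0 addr0 lerDl.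
  exact: mulr_ge0 (ltW (rate_coef_gt0 k)) mu_ge.
have [_|muL] := eqVneq mu (load D y); first by rewrite addey // leey.
have d0 : 0 < mu - load D y by rewrite lt_def mu_ge subr_eq0 muL.
rewrite -EFinD lee_fin [_ * (_ / _)]mulrA -!addrA !lerD2l.
apply: sqrt_le_hyperbola d0; first exact: rate_coef_gt0.
by rewrite mulr_ge0 ?load_ge0 // ltW.
Qed.

(** With a positive load the slack of [mu_opt] is the positive minimizer of the
    hyperbola; without load it is 0, where the waiting cost is 0 as well. *)
Lemma tangent_obj_mu_opt (k : K) (y : {ffun J -> bool}) :
  tangent_obj k (mu_opt D i k y, y) = (p D i k + binary_obj D i u k y)%:E.
Proof.
rewrite tangent_objE /waiting /binary_obj sum_r_load /mu_opt.
have [L0|L0] := eqVneq (load D y) 0.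
  by rewrite L0 !(mulr0, mul0r, sqrtr0, addr0, subr0, adde0).
have b0 : 0 < wait_cost D i * load D y.
  by rewrite mulr_gt0 // lt_def L0 load_ge0.
have d0 : 0 < Num.sqrt (wait_cost D i * load D y / A k).
  by rewrite sqrtr_gt0 divr_gt0 // rate_coef_gt0.
(* The slack is nonzero, so the waiting cost is in its finite regime. *)
rewrite -subr_eq0 [load D y + _]addrC !addrK gt_eqF // -EFinD.
rewrite -(hyperbola_at_min (rate_coef_gt0 k) b0) [_ * (_ / _)]mulrA.
by rewrite !addrA.
Qed.

Lemma feasible_mu_opt (k : K) (y : {ffun J -> bool}) :
  feasible D (mu_opt D i k y, y).
Proof.
by split; rewrite /= /mu_opt 1?[load _ _ + _]addrC ?addrK ?addr_ge0
  ?sqrtr_ge0 ?load_ge0.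
Qed.

Lemma z_le (k : K) (y : {ffun J -> bool}) :
  z D i u k <= p D i k + binary_obj D i u k y.
Proof. by rewrite /z lerD2l; apply: bigmin_le. Qed.

Lemma z_minimizer (k : K) (y : {ffun J -> bool}) :
  minimizer [set: {ffun J -> bool}] (binary_obj D i u k) y ->
  z D i u k = p D i k + binary_obj D i u k y.
Proof.
move=> [_ ymin]; apply/le_anti; rewrite z_le /z lerD2l.
by apply: le_bigmin => [|y' _]; apply: ymin.
Qed.

End Subproblem.

Theorem theorem1 (R : realType) (I J K : finType) (D : ssd_data R I J K)
    (hK : (0 < #|K|)%N)
    (hlambda : forall j : J, 0 <= demand D j)
    (hc : forall i : I, 0 < oper_cost D i)
    (hw : forall i : I, 0 < wait_cost D i)
    (hconcave : forall i : I, concave_on_rates (cap_fun D i))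
    (hmono : forall i : I, nondecreasing_on_rates (cap_fun D i))
    (hdiff : forall (i : I) (k : K), derivable (cap_fun D i) (tangent_pt D k) 1)
    (hslope : forall (i : I) (k : K), 0 < slope D i k)
    (i : I) (u : J -> R)
    (ki : K) (hki : minimizer [set: K] (z D i u) ki)
    (ystar : {ffun J -> bool})
    (hystar : minimizer [set: {ffun J -> bool}] (binary_obj D i u ki) ystar) :
  minimizer (feasible D) (objective D i u) (mu_opt D i ki ystar, ystar).
Proof.
have [_ ki_min] := hki; split; first exact: feasible_mu_opt.
move=> m m_feas.
have tangents_above k : ((z D i u ki)%:E <= tangent_obj D i u k m)%E.
  apply: le_trans (tangent_obj_ge u hlambda (hc i) (hw i) (hslope i) k m_feas).
  by rewrite lee_fin; apply: le_trans (z_le _ _ _ _ _); apply: ki_min.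
apply: (@le_trans _ _ (z D i u ki)%:E).
  rewrite (z_minimizer hystar).
  rewrite -(tangent_obj_mu_opt u hlambda (hc i) (hw i) (hslope i)).
  exact: bigmin_le.
by apply: le_bigmin => [|k _]; [exact: leey | exact: tangents_above].
Qed.
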